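(* An optimal EL function is not necessarily unique: there exist an s-surface $S\subseteq\mathbb{R}^2_{\ge0}$ with $\mathrm{OPT}(S)<+\infty$ and two $S$-feasible EL functions $f,g:\mathbb{R}^2_{\ge0}\to\mathbb{R}$, $f$ not a function equal to $g$ on all of $\mathbb{R}^2_{\ge 0}$ (i.e. $f\ne g$), such that $\mathrm{Cost}(f)=\mathrm{Cost}(g)=\mathrm{OPT}(S)$.
   Context: Notation: $\mathbb{R}^2_{\ge0}=\{x\in\mathbb{R}^2: x_1,x_2\ge 0\}$; $x\le y$ means $x_i\le y_i$ for $i=1,2$; $\min(x,y)$ and $\max(x,y)$ are taken coordinatewise; $e_i$ is the $i$-th unit vector. EL function: a function $f:\mathbb{R}^2_{\ge0}\to\mathbb{R}$ is entropy-like (EL) if (1) it is submodular: $f(x)+f(y)\ge f(\min(x,y))+f(\max(x,y))$ for all $x,y\in\mathbb{R}^2_{\ge0}$; (2) $f(0)=0$; (3) $f$ is non-decreasing: $0\le x\le y$ implies $f(x)\le f(y)$; (4) it has the Diminishing Returns property: for every $x\ge0$, every $i$, every $\lambda>0$ and $\varepsilon>0$, with $y=x+\lambda e_i$, one has $f(x+\varepsilon e_i)-f(x)\ge f(y+\varepsilon e_i)-f(y)$. Left and right partial derivatives: $f^-_i(x)=\lim_{\varepsilon\to+0}\frac{f(x)-f(x-\varepsilon e_i)}{\varepsilon}$ (for $x_i>0$) and $f^+_i(x)=\lim_{\varepsilon\to+0}\frac{f(x+\varepsilon e_i)-f(x)}{\varepsilon}$; the value $+\infty$ is allowed for $f_i^+$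 when $x_i=0$. Cost: $\mathrm{Cost}(f)=\max\{f^+_1(0),f^+_2(0)\}$, which may be $+\infty$. s-surface (in dimension 2): a smooth curve $S\subseteq\mathbb{R}^2_{\ge0}$ separating a downward closed set of (''unqualified'') points of $\mathbb{R}^2_{\ge0}$ containing the origin from the remaining (''qualified'') points, such that (a) $0\notin S$, (b) $S$ is compact, and (c) for every $p\in S$ the normal vector $\nabla S(p)$ of $S$ at $p$ pointing outwards (towards the qualified points) has strictly positive coordinates. (A set $D$ is downward closed if $x\in D$ and $0\le y\le x$ imply $y\in D$.) Feasibility: an EL function $f$ is $S$-feasible if $f^-_i(p)-f^+_i(p)\ge1$ for $i=1,2$ and all $p\in S$ with both coordinates strictly positive. $\mathrm{OPT}(S)$ is the infimum of $\mathrm{Cost}(f)$ over all $S$-feasible EL functions $f$ ($+\infty$ if there are none). *)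

(* Defs.v *)
From mathcomp Require Import all_boot all_order all_algebra.
From mathcomp Require Import all_classical all_reals all_analysis.

Set Implicit Arguments.
Unset Strict Implicit.
Unset Printing Implicit Defensive.

Import Order.TTheory GRing.Theory Num.Theory.
Import numFieldNormedType.Exports.

Local Open Scope classical_set_scope.
Local Open Scope ring_scope.

Section EntropyLike.
Variable R : realType.
Local Notation plane := 'rV[R]_2.
Implicit Types (f : plane -> R) (i : 'I_2) (x y p n : plane).

Definition unit_vec i : plane := delta_mx 0 i.

Definition le_coord x y : Prop := forall i, x 0 i <= y 0 i.

Definition min_coord x y : plane := \row_i Num.min (x 0 i) (y 0 i).

Definition max_coord x y : plane := \row_i Num.max (x 0 i) (y 0 i).

Definition quadrant : set plane := [set x | le_coord 0 x].

(* A function on the quadrant is represented by a function on the whole plane;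
   being entropy-like or feasible, and the cost, depend only on its values on
   the quadrant. *)

Definition submodular f : Prop :=
  forall x y, quadrant x -> quadrant y ->
    f (min_coord x y) + f (max_coord x y) <= f x + f y.

Definition nondecreasing_on_quadrant f : Prop :=
  forall x y, quadrant x -> le_coord x y -> f x <= f y.

Definition diminishing_returns f : Prop :=
  forall x i (l e : R), quadrant x -> 0 < l -> 0 < e ->
    let y := x + l *: unit_vec i in
    f (y + e *: unit_vec i) - f y <= f (x + e *: unit_vec i) - f x.

Definition entropy_like f : Prop :=
  [/\ submodular f, f 0 = 0, nondecreasing_on_quadrant f
    & diminishing_returns f].

(* An entropy-like f is concave along each axis direction (monotone plus
   diminishing returns), so both limits exist in \bar R at every point of the
   quadrant (with 0 < x_i for the left one); only the right derivative at
   x_i = 0 can be infinite. *)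

Definition left_partial f i x : \bar R :=
  lim (((f x - f (x - e *: unit_vec i)) / e)%:E @[e --> 0^'+]).

Definition right_partial f i x : \bar R :=
  lim (((f (x + e *: unit_vec i) - f x) / e)%:E @[e --> 0^'+]).

Definition cost f : \bar R :=
  Order.max (right_partial f 0 0) (right_partial f 1 0).

Definition downward_closed (D : set plane) : Prop :=
  forall x y, D x -> le_coord 0 y -> le_coord y x -> D y.

(* S is a compact smooth curve with regular parametrization c on [0, 1].  That
   c is smooth on the whole line is no restriction: a smooth map on a closed
   interval extends smoothly. *)
Definition smooth_curve (c : R -> plane) (S : set plane) : Prop :=
  [/\ forall (k : nat) (t : R), derivable c^`(k)%classic t 1,
      forall t : R, t \in `[0, 1] -> c^`()%classic t != 0,
      {in `[0, 1] &, injective c}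
    & S = c @` `[0, 1]].

(* S is the common boundary of D and the rest of the quadrant. *)
Definition separates (S D : set plane) : Prop :=
  S = closure D `&` closure (quadrant `\` D).

(* n is normal to the curve c at c t and points from D towards the rest of the
   quadrant; this determines n up to a positive factor.  At an endpoint of the
   curve on a coordinate axis, c t - e *: n may lie outside the quadrant, hence
   the second condition is not stated as membership in D. *)
Definition outward_normal (D : set plane) (c : R -> plane) (t : R) n : Prop :=
  [/\ n != 0,
      \sum_(i < 2) n 0 i * (c^`()%classic t) 0 i = 0
    & \forall e \near 0^'+, (quadrant `\` D) (c t + e *: n) /\
                            ~ (quadrant `\` D) (c t - e *: n)].

Definition s_surface (S : set plane) : Prop :=
  S `<=` quadrant /\
  exists (D : set plane) (c : R -> plane),
    [/\ [/\ D `<=` quadrant, D 0 & downward_closed D],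
        smooth_curve c S /\ separates S D,
        ~ S 0,
        compact S
      & forall t : R, t \in `[0, 1] ->
          exists2 n, outward_normal D c t n & forall i, 0 < n 0 i].

Definition feasible (S : set plane) f : Prop :=
  forall p, S p -> (forall i, 0 < p 0 i) ->
    forall i, (1 <= left_partial f i p - right_partial f i p)%E.

(* The infimum of the empty set is +oo. *)
Definition OPT (S : set plane) : \bar R :=
  ereal_inf [set cost f | f in [set f | entropy_like f /\ feasible S f]].

End EntropyLike.

Arguments quadrant {R}.

(* Main.v *)
Require Import Defs.
From mathcomp Require Import all_boot all_order all_algebra.
From mathcomp Require Import all_classical all_reals all_analysis.
From mathcomp Require Import ring lra.

Set Implicit Arguments.
Unset Strict Implicit.
Unset Printing Implicit Defensive.

Import Order.TTheory GRing.Theory Num.Theory.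
Import numFieldNormedType.Exports.

Local Open Scope classical_set_scope.
Local Open Scope ring_scope.

(** The surface is the segment 2 x1 + x2 = 2 of the quadrant, whose normal has
    direction (2, 1); the optimal cost is 2, and it is attained by both of
      f x = min (2 x1 + x2, 2)   and   g x = min (2 x1 + x2, 2) + x2.
    A gap of at least 1 in the second direction forces a gap of at least 2 in
    the first one, because the gradient of a piecewise smooth function jumps
    across a curve only along the normal.  So the first direction alone determines the cost, and
    there is slack in the second direction: adding x2 changes no gap and raises
    the second slope at the origin only from 1 to 2.

    The lower bound ([segment_cost_ge]) has to hold for feasible functions that
    are not differentiable away from the segment.  For two points p and
    p' = p + (h, - 2 h) of the segment, compare the four corners of the
    rectangle that they span: by feasibility at p the left edge carries an
    increase of at least 2 h (1 + d p), where d p is the right partial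
    derivative of f in direction 2 at p; the right edge carries at most
    2 h (d p'), the top edge at least 0, and the bottom edge at most f (h, 0) by
    submodularity and diminishing returns ([staircase_step]).  Summing over n
    equal steps between two fixed interior points of the segment, the terms d
    telescope to a bounded quantity, and n going to infinity gives a slope of at
    least 2 at the origin.

    The partial derivatives are defined as limits, so one first needs that
    these limits exist and compare with the difference quotients.  This holds
    because an entropy-like function is concave along each axis direction
    ([chord_slope_le]), which makes the quotients monotone. *)

(** * Coordinates in the plane *)

Section Coordinates.
Variable R : realType.
Implicit Types (x y : 'rV[R]_2) (i : 'I_2) (a b h t : R).

Definition vec2 a b : 'rV[R]_2 := \row_j (if j == 0 then a else b).

Lemma ord2_ind (P : 'I_2 -> Prop) : P 0 -> P 1 -> forall i, P i.
Proof.
by move=> P0 P1 [[|[|//]] lti];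
   [rewrite (_ : Ordinal _ = 0)|rewrite (_ : Ordinal _ = 1)] => //;
   apply: val_inj.
Qed.

Lemma le_coordE x y : le_coord x y <-> x 0 0 <= y 0 0 /\ x 0 1 <= y 0 1.
Proof.
split=> [xy|[xy0 xy1] i]; first by split; exact: xy.
by elim/ord2_ind: i.
Qed.

Lemma quadrantE x : quadrant x <-> 0 <= x 0 0 /\ 0 <= x 0 1.
Proof. by rewrite /quadrant /= le_coordE !mxE. Qed.

Lemma row2P x y : x 0 0 = y 0 0 -> x 0 1 = y 0 1 -> x = y.
Proof.
move=> xy0 xy1; apply/rowP => i.
by elim/ord2_ind: i.
Qed.

Lemma vec2_add0 a b h : vec2 a b + h *: unit_vec R 0 = vec2 (a + h) b.
Proof. by apply: row2P; rewrite !mxE /= ?mulr1 ?mulr0 ?addr0. Qed.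

Lemma vec2_add1 a b h : vec2 a b + h *: unit_vec R 1 = vec2 a (b + h).
Proof. by apply: row2P; rewrite !mxE /= ?mulr1 ?mulr0 ?addr0. Qed.

Lemma vec2_sub1 a b h : vec2 a b - h *: unit_vec R 1 = vec2 a (b - h).
Proof. by rewrite -scaleNr vec2_add1. Qed.

Lemma quadrant_vec2 a b : 0 <= a -> 0 <= b -> quadrant (vec2 a b).
Proof. by move=> a0 b0; apply/quadrantE; rewrite !mxE. Qed.

Lemma quadrant_shift x i (t : R) :
  quadrant x -> - x 0 i <= t -> quadrant (x + t *: unit_vec R i).
Proof.
move=> Qx xt j; have := Qx j; rewrite !mxE eqxx /=.
by case: eqP => [->|_]; rewrite ?mulr1 ?mulr0; lra.
Qed.

End Coordinates.

(** * Diminishing returns and monotonicity imply concavity *)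

Section OneVariable.
Variable R : realType.

(** For nonincreasing increments, the average of the first k increments is at
    least the average of the first n. *)
Lemma average_increment_le (u : nat -> R) (k n : nat) :
  (forall j, u j.+2 - u j.+1 <= u j.+1 - u j) -> (k <= n)%N ->
  k%:R * (u n - u 0) <= n%:R * (u k - u 0).
Proof.
move=> dec.
have last_le j : j%:R * (u j.+1 - u j) <= u j - u 0.
  elim: j => [|j IH]; first by rewrite mul0r subrr.
  have := ler_wpM2l (ler0n R j.+1) (dec j).
  rewrite -natr1 in IH *; lra.
have succ_le j : j%:R * (u j.+1 - u 0) <= j.+1%:R * (u j - u 0).
  have := last_le j; rewrite -natr1; lra.
elim: n => [|n IH]; first by rewrite leqn0 => /eqP ->.
rewrite leq_eqVlt => /predU1P[->//|]; rewrite ltnS => kn.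
have [n0|n0] := posnP n.
  by move: kn; rewrite n0 leqn0 => /eqP ->; rewrite mul0r subrr mulr0.
have n0R : 0 < n%:R :> R by rewrite ltr0n.
have := ler_wpM2l (ler0n R k) (succ_le n).
have := ler_wpM2l (ler0n R n.+1) (IH kn).
by move=> h1 h2; rewrite -(ler_pM2l n0R); lra.
Qed.

(** When s / t is rational this is [average_increment_le] on a common grid.
    Monotonicity handles real ratios: round s down to a grid of mesh t / n, at
    the price of an error of order 1 / n. *)
Lemma chord_slope_le (G : R -> R) (s t : R) :
  (forall a b, 0 <= a -> a <= b -> G a <= G b) ->
  (forall a l e, 0 <= a -> 0 < l -> 0 < e ->
    G (a + l + e) - G (a + l) <= G (a + e) - G a) ->
  0 < s -> s <= t -> s * (G t - G 0) <= t * (G s - G 0).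
Proof.
move=> mono dr s0 st; have t0 : 0 < t by lra.
have Gt0 : 0 <= G t - G 0 by have := mono 0 t; lra.
have bound (n : nat) : (0 < n)%N ->
    n%:R * (s * (G t - G 0) - t * (G s - G 0)) <= t * (G t - G 0).
  move=> n0; have n0R : 0 < n%:R :> R by rewrite ltr0n.
  pose k := Num.truncn (n%:R * s / t).
  have /andP[k1 k2] : k%:R <= n%:R * s / t < k.+1%:R.
    by apply: truncn_itv; rewrite divr_ge0 ?mulr_ge0 ?ltW.
  have kn : (k <= n)%N.
    rewrite -(ler_nat R); apply: (le_trans k1).
    by rewrite ler_pdivrMr// ler_wpM2l// ltW.
  pose d := t / n%:R; have d0 : 0 < d by rewrite divr_gt0.
  have nd : n%:R * d = t by rewrite /d; field; rewrite lt0r_neq0.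
  have := @average_increment_le (fun j => G (j%:R * d)) k n _ kn.
  rewrite mul0r nd => /(_ _)H.
  have {}H : k%:R * (G t - G 0) <= n%:R * (G (k%:R * d) - G 0).
    apply: H => j.
    have := dr (j%:R * d) d d; rewrite -!natr1 !mulrDl !mul1r => -> //.
    by rewrite mulr_ge0// ltW.
  have kds : k%:R * d <= s.
    by move: k1; rewrite ler_pdivlMr// -nd mulrCA ler_pM2l.
  have H2 : G (k%:R * d) <= G s by apply: mono => //; rewrite mulr_ge0// ltW.
  move: k2; rewrite ltr_pdivrMr// -natr1 => k2.
  have := ler_wpM2l (ltW t0) H.
  have := ler_wpM2r Gt0 (ltW k2).
  have := ler_wpM2l (mulr_ge0 (ltW t0) (ltW n0R)) H2.
  lra.
rewrite leNgt; apply/negP => lt_st.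
set X := s * (G t - G 0) - t * (G s - G 0) in bound.
have X0 : 0 < X by rewrite /X; lra.
set T := t * (G t - G 0) in bound.
have T0 : 0 <= T by rewrite mulr_ge0// ltW.
have := bound (Num.truncn (T / X)).+1 isT.
rewrite leNgt -ltr_pdivrMr// => /negP; apply.
by have /andP[] := truncn_itv (divr_ge0 T0 (ltW X0)).
Qed.

End OneVariable.

(** * Partial derivatives against difference quotients *)

Section EntropyLikeFunctions.
Variables (R : realType) (f : 'rV[R]_2 -> R).
Hypothesis f_el : entropy_like f.
Implicit Types (x : 'rV[R]_2) (i : 'I_2).

Lemma el_slope_le x i s t : quadrant x -> 0 < s -> s <= t ->
  s * (f (x + t *: unit_vec R i) - f x) <=
  t * (f (x + s *: unit_vec R i) - f x).
Proof.
case: f_el => _ _ mono dr Qx s0 st.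
have xi : 0 <= x 0 i by have := Qx i; rewrite mxE.
have := @chord_slope_le R (fun r => f (x + r *: unit_vec R i)) s t _ _ s0 st.
rewrite scale0r addr0; apply.
- move=> a b a0 ab; apply: mono.
    by apply: quadrant_shift => //; lra.
  move=> j; rewrite !mxE lerD2l eqxx /=.
  by case: eqP; rewrite ?mulr1 ?mulr0.
- move=> a l e a0 l0 e0; have := dr (x + a *: unit_vec R i) i l e.
  rewrite !scalerDl !addrA; apply => //.
  by apply: quadrant_shift => //; lra.
Qed.

Lemma right_quotient_le x i e : quadrant x -> 0 < e ->
  (((f (x + e *: unit_vec R i) - f x) / e)%:E <= right_partial f i x)%E.
Proof.
move=> Qx e0; apply: lime_ge.
  apply: nonincreasing_at_right_is_cvge; near=> b => s t.
  rewrite !in_itv/= => /andP[s0 _] /andP[t0 _] st.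
  rewrite lee_fin ler_pdivlMr// mulrAC ler_pdivrMr// [leLHS]mulrC [leRHS]mulrC.
  exact: el_slope_le.
near=> s; have s0 : 0 < s by near: s; exact: nbhs_right_gt.
have se : s <= e by near: s; exact: nbhs_right_le.
rewrite lee_fin ler_pdivlMr// mulrAC ler_pdivrMr// [leLHS]mulrC [leRHS]mulrC.
exact: el_slope_le.
Unshelve. all: by end_near. Qed.

Lemma left_slope_le x i s t : quadrant x -> 0 < s -> s <= t -> t <= x 0 i ->
  t * (f x - f (x - s *: unit_vec R i)) <=
  s * (f x - f (x - t *: unit_vec R i)).
Proof.
move=> Qx s0 st tx; move: (st); rewrite le_eqVlt => /predU1P[->//|st'].
(* This is concavity on the segment that starts at x - t e_i. *)
have Qy : quadrant (x + (- t) *: unit_vec R i).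
  by apply: quadrant_shift => //; lra.
have := @el_slope_le _ i (t - s) t Qy.
rewrite -!addrA -!scalerDl addNr scale0r addr0 -scaleNr.
rewrite (_ : - t + (t - s) = - s) ?scaleNr; last by ring.
by move=> /(_ ltac:(lra) ltac:(lra)); lra.
Qed.

Lemma left_quotient_ge x i e : quadrant x -> 0 < e -> e <= x 0 i ->
  (left_partial f i x <= ((f x - f (x - e *: unit_vec R i)) / e)%:E)%E.
Proof.
move=> Qx e0 ex; apply: lime_le.
  apply: nondecreasing_at_right_is_cvge; near=> b => s t.
  have bx : b <= x 0 i by near: b; apply: nbhs_right_le; lra.
  rewrite !in_itv/= => /andP[s0 _] /andP[t0 tb] st.
  rewrite lee_fin ler_pdivlMr// mulrAC ler_pdivrMr// [leLHS]mulrC [leRHS]mulrC.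
  by apply: left_slope_le => //; lra.
near=> s; have s0 : 0 < s by near: s; exact: nbhs_right_gt.
have se : s <= e by near: s; exact: nbhs_right_le.
rewrite lee_fin ler_pdivlMr// mulrAC ler_pdivrMr// [leLHS]mulrC [leRHS]mulrC.
exact: left_slope_le.
Unshelve. all: by end_near. Qed.

End EntropyLikeFunctions.

(** * The cost of a function feasible for the segment is at least 2 *)

Section LowerBound.
Variable R : realType.
Implicit Types (f : 'rV[R]_2 -> R) (p x y : 'rV[R]_2) (i : 'I_2) (a b h e : R).

Definition segment : set 'rV[R]_2 :=
  [set x | quadrant x /\ 2 * x 0 0 + x 0 1 = 2].

(** The gap condition makes the right partial derivative finite, since the left
    one is bounded above by a difference quotient; so it can be used as a real
    number d in estimates of the increments on both sides of p. *)
Lemma gap_increments f p i : entropy_like f -> quadrant p -> 0 < p 0 i ->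
  (1 <= left_partial f i p - right_partial f i p)%E ->
  let d := fine (right_partial f i p) in
  [/\ 0 <= d,
      forall e, 0 < e -> f (p + e *: unit_vec R i) - f p <= e * d
    & forall e, 0 < e -> e <= p 0 i ->
        e * (1 + d) <= f p - f (p - e *: unit_vec R i)].
Proof.
move=> f_el Qp pi0 gap d.
have Rge := @right_quotient_le R f f_el p i _ Qp.
have Lle := @left_quotient_ge R f f_el p i _ Qp.
have R0 : (0 <= right_partial f i p)%E.
  apply: le_trans (Rge 1 ltr01); rewrite lee_fin divr1 subr_ge0.
  case: f_el => _ _ mono _; apply: mono => // j.
  by rewrite !mxE eqxx /= mul1r lerDl ler0n.
move: gap Rge Lle R0; rewrite /d.
case: (right_partial f i p) => [r| |] //=; last first.
  by case: (left_partial f i p).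
case: (left_partial f i p) => [l| |] //=; last first.
  by move=> _ _ /(_ _ pi0 (lexx _)).
rewrite !lee_fin => gap Rge Lle r0; split => //.
  by move=> e e0; have := Rge e e0; rewrite lee_fin ler_pdivrMr// mulrC.
move=> e e0 ep; have := Lle e e0 ep; rewrite lee_fin ler_pdivlMr// => lee.
have := ler_wpM2r (ltW e0) gap; lra.
Qed.

(** Diminishing returns moves the increment to the axis x1 = 0, and
    submodularity then moves it down to the origin. *)
Lemma increment0_le f a b h : entropy_like f -> 0 < a -> 0 <= b -> 0 < h ->
  f (vec2 (a + h) b) - f (vec2 a b) <= f (vec2 h 0).
Proof.
case=> sub f0 _ dr a0 b0 h0.
have := dr (vec2 0 b) 0 a h (quadrant_vec2 (lexx 0) b0) a0 h0.
rewrite /= !vec2_add0 !add0r => dr_a.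
have := sub (vec2 h 0) (vec2 0 b) (quadrant_vec2 (ltW h0) (lexx 0))
  (quadrant_vec2 (lexx 0) b0).
rewrite (_ : min_coord _ _ = 0); last first.
  by apply: row2P; rewrite !mxE /= ?(min_idPr (ltW h0)) ?(min_idPl b0).
rewrite (_ : max_coord _ _ = vec2 h b); last first.
  by apply: row2P; rewrite !mxE /= ?(max_idPl (ltW h0)) ?(max_idPr b0).
lra.
Qed.

Section FeasibleFunction.
Variable f : 'rV[R]_2 -> R.
Hypotheses (f_el : entropy_like f) (f_feas : feasible segment f).

Let d a := fine (right_partial f 1 (vec2 a (2 - 2 * a))).

Let gap a : 0 < a -> a < 1 ->
  [/\ 0 <= d a,
      forall e, 0 < e ->
        f (vec2 a (2 - 2 * a + e)) - f (vec2 a (2 - 2 * a)) <= e * d a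
    & forall e, 0 < e -> e <= 2 - 2 * a ->
        e * (1 + d a) <=
        f (vec2 a (2 - 2 * a)) - f (vec2 a (2 - 2 * a - e))].
Proof.
move=> a0 a1; have Q : quadrant (vec2 a (2 - 2 * a)).
  by apply: quadrant_vec2; lra.
have pos i : 0 < vec2 a (2 - 2 * a) 0 i.
  by rewrite mxE; case: ifP => _ //; lra.
have S : segment (vec2 a (2 - 2 * a)) by split => //; rewrite !mxE /=; lra.
have [d0 dr dl] := gap_increments f_el Q (pos 1) (f_feas S pos 1).
split=> // e e0; first by have := dr e e0; rewrite vec2_add1.
by move=> ea; have := dl e e0; rewrite mxE /= vec2_sub1; exact.
Qed.

(** The edges of the rectangle with corners (a, 2 - 2 a) and
    (a + h, 2 - 2 (a + h)) give left - right = bottom - top <= bottom. *)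
Lemma staircase_step a h : 0 < a -> 0 < h -> a + h < 1 ->
  2 * h * (1 + d a - d (a + h)) <= f (vec2 h 0).
Proof.
move=> a0 h0 ah1.
have [_ _ /(_ (2 * h) ltac:(lra) ltac:(lra)) left_a] := gap a0 ltac:(lra).
have [_ /(_ (2 * h) ltac:(lra)) right_ah _] := gap (addr_gt0 a0 h0) ah1.
have bottom := @increment0_le f a (2 - 2 * a - 2 * h) h f_el a0 ltac:(lra) h0.
have top : f (vec2 a (2 - 2 * a)) <= f (vec2 (a + h) (2 - 2 * a)).
  case: f_el => _ _ mono _; apply: mono; first by apply: quadrant_vec2; lra.
  by apply/le_coordE; rewrite !mxE /=; lra.
move: right_ah; rewrite (_ : 2 - 2 * (a + h) = 2 - 2 * a - 2 * h); last lra.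
rewrite subrK; lra.
Qed.

(** If the slope r at the origin were below 2, the telescoped inequality
    2 (n + d (1/4) - d (1/2)) <= n r on n steps from x1 = 1/4 to x1 = 1/2 would
    fail for n > 2 d (1/2) / (2 - r). *)
Lemma segment_cost_ge : (2%:E <= right_partial f 0%R 0%R)%E.
Proof.
have Q0 : quadrant (0 : 'rV[R]_2) by apply/quadrantE; rewrite !mxE.
have quot h : 0 < h -> ((f (vec2 h 0) / h)%:E <= right_partial f 0%R 0%R)%E.
  move=> h0; have := @right_quotient_le R f f_el 0 0 h Q0 h0.
  rewrite (_ : 0 = vec2 0 0) ?vec2_add0 ?add0r; last first.
    by apply: row2P; rewrite !mxE.
  case: f_el => _ + _ _; rewrite (_ : 0 = vec2 0 0) => [->|]; last first.
    by apply: row2P; rewrite !mxE.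
  by rewrite subr0.
move: quot; case: (right_partial f 0 0) => [r| |] quot; last 2 first.
- by rewrite leey.
- by have := quot 1 ltr01.
rewrite lee_fin leNgt; apply/negP => r2.
have {}quot h : 0 < h -> f (vec2 h 0) <= r * h.
  by move=> h0; have := quot h h0; rewrite lee_fin ler_pdivrMr.
have [d4 _ _] := gap (a := 4^-1) ltac:(lra) ltac:(lra).
have [d2 _ _] := gap (a := 2^-1) ltac:(lra) ltac:(lra).
have X0 : 0 <= 2 * d 2^-1 / (2 - r) by rewrite divr_ge0; lra.
pose n := (Num.truncn (2 * d 2^-1 / (2 - r))).+1.
have n_large : 2 * d 2^-1 < n%:R * (2 - r).
  rewrite -ltr_pdivrMr; last by lra.
  by have /andP[] := truncn_itv X0.
have n0 : 0 < n%:R :> R by rewrite ltr0n.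
pose h := (4 * n%:R)^-1 : R.
have h0 : 0 < h by rewrite invr_gt0; lra.
have nh : n%:R * h = 4^-1 by rewrite /h; field; rewrite lt0r_neq0.
have walk k : (k <= n)%N ->
    2 * (k%:R + d 4^-1 - d (4^-1 + k%:R * h)) <= k%:R * r.
  elim: k => [|k IH] kn; first by rewrite !mul0r addr0; lra.
  have kh0 : 0 <= k%:R * h by rewrite mulr_ge0// ltW.
  have khn : k.+1%:R * h <= n%:R * h by rewrite ler_pM2r// ler_nat.
  have := @staircase_step (4^-1 + k%:R * h) h ltac:(lra) h0.
  move: khn; rewrite -natr1 mulrDl mul1r nh addrA => khn.
  move=> /(_ ltac:(lra)) /le_trans /(_ (quot h h0)).
  rewrite mulrAC ler_pM2r//; have := IH (ltnW kn); lra.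
have := walk n (leqnn n).
rewrite nh (_ : 4^-1 + 4^-1 = 2^-1); last by lra.
lra.
Qed.

End FeasibleFunction.
End LowerBound.

(** * The segment is an s-surface *)

Section Segment.
Variable R : realType.
Implicit Types (x y n : 'rV[R]_2) (t e : R).

Definition below : set 'rV[R]_2 :=
  [set x | quadrant x /\ 2 * x 0 0 + x 0 1 <= 2].

Lemma is_derive_line (V : normedModType R) (A B : V) t :
  is_derive t 1 (fun s => A + s *: B) B.
Proof.
have q : \forall h \near (0 : R)^',
    h^-1 *: (((fun s => A + s *: B) \o shift t) (h *: 1) - (A + t *: B)) = B.
  near=> h; have h0 : h != 0 by near: h; exact: nbhs_dnbhs_neq.
  rewrite /= scalerDl opprD addrACA subrr add0r addrK.
  by rewrite scalerA [h *: 1]mulr1 mulVf// scale1r.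
apply: DeriveDef; last exact: lim_near_cst.
apply: cvgP; exact: cvg_near_cst q.
Unshelve. all: by end_near. Qed.

Lemma derive1_line (V : normedModType R) (A B : V) :
  ((fun s => A + s *: B)^`())%classic = cst B.
Proof.
apply/funext => t; rewrite derive1E.
exact: (@derive_val _ _ _ _ _ _ _ (is_derive_line A B t)).
Qed.

Lemma derivable_line (V : normedModType R) (A B : V) (k : nat) t :
  derivable (derive1n k (fun s => A + s *: B)) t 1.
Proof.
case: k => [|k]; first by case: (is_derive_line A B t).
rewrite (_ : derive1n _ _ = cst (if k is 0%N then B else 0)); last first.
  elim: k => [|k IH]; first exact: derive1_line.
  by rewrite derive1nS IH; apply/funext => s; rewrite derive1_cst.
exact: derivable_cst.
Qed.

Lemma continuous_line (V : normedModType R) (A B : V) :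
  continuous (fun s : R => A + s *: B).
Proof.
move=> t; apply: differentiable_continuous; apply/derivable1_diffP.
by case: (is_derive_line A B t).
Qed.

Let c t : 'rV[R]_2 := vec2 0 2 + t *: vec2 1 (- 2).

Let cE t : c t = vec2 t (2 - 2 * t).
Proof. by apply: row2P; rewrite !mxE /=; lra. Qed.

Let n : 'rV[R]_2 := vec2 2 1.

Lemma segment_image : @segment R = c @` `[0, 1]%classic.
Proof.
apply/seteqP; split=> [x [/quadrantE[x0 x1] sx]|_ [t + <-]].
  exists (x 0 0); first by rewrite /= in_itv /=; lra.
  by rewrite cE; apply: row2P; rewrite !mxE //=; lra.
rewrite /= in_itv /= cE => ?; split; last by rewrite !mxE /=; lra.
by apply: quadrant_vec2; lra.
Qed.

Lemma segment_outward_normal t : t \in `[0, 1] -> outward_normal below c t n.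
Proof.
rewrite in_itv /= => t01; split.
- by apply/eqP => /rowP/(_ 1); rewrite !mxE /= => /eqP; rewrite oner_eq0.
- by rewrite derive1_line big_ord_recl big_ord1 !mxE /=; lra.
near=> e; have e0 : 0 < e by near: e; exact: nbhs_right_gt.
rewrite cE; split.
  split; first by apply/quadrantE; rewrite !mxE /=; lra.
  by case=> _; rewrite !mxE /=; lra.
by case=> Q; apply; split => //; rewrite !mxE /=; lra.
Unshelve. all: by end_near. Qed.

Lemma segment_separates : separates (@segment R) below.
Proof.
pose L x := 2 * x 0 0 + x 0 1.
have Lc : continuous L.
  move=> x; have coord i := @coord_continuous R 1 2 0 i x.
  exact: (cvgD (cvgMl_tmp (coord 0)) (coord 1)).
have le_closed : closed [set x | L x <= 2].
  apply: (@preimage_closed _ _ L [set y | y <= 2]); last exact: closed_le.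
  by move=> x _; exact: Lc.
have ge_closed : closed [set x | 2 <= L x].
  apply: (@preimage_closed _ _ L [set y | 2 <= y]); last exact: closed_ge.
  by move=> x _; exact: Lc.
have coord_closed i : closed [set x : 'rV[R]_2 | 0 <= x 0 i].
  apply: (@preimage_closed _ _ (fun x : 'rV[R]_2 => x 0 i) [set y | 0 <= y]).
    by move=> x _; exact: coord_continuous.
  exact: closed_ge.
have quadrant_closed : closed (@quadrant R).
  rewrite (_ : quadrant = [set x | 0 <= x 0 0] `&` [set x | 0 <= x 0 1]);
    last by apply/seteqP; split=> x /quadrantE.
  by apply: closedI; exact: coord_closed.
apply/seteqP; split=> x.
  move=> Sx; split.
    by apply: subset_closure; case: Sx => Qx Lx; split; rewrite ?Lx.
  (* Points above the segment accumulate at c t along the outward normal. *)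
  move: Sx; rewrite segment_image => -[t t01 <-] B nB.
  have [_ _ outward] := segment_outward_normal t01.
  have ray : c t + e *: n @[e --> 0^'+] --> c t.
    apply: cvg_at_right_filter.
    have := @continuous_line _ (c t) n 0.
    by rewrite /continuous_at scale0r addr0.
  have [e [[Ue _] Be]] := filter_ex (filterI outward (ray B nB)).
  by exists (c t + e *: n).
case=> Dx Ux.
have inside (A E : set 'rV[R]_2) : closed E -> A `<=` E -> closure A `<=` E.
  by rewrite closureE; exact: smallest_sub.
have Qx : quadrant x by apply: inside Dx => // y [].
split=> //; apply/eqP; rewrite eq_le; apply/andP; split.
  by apply: (inside _ _ le_closed) Dx => y [].
apply: (inside _ _ ge_closed) Ux => y [Qy nD] /=.
by rewrite leNgt; apply/negP => Ly; apply: nD; split => //; exact: ltW.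
Qed.

Lemma segment_s_surface : s_surface (@segment R).
Proof.
split; first by move=> x [].
exists below, c; split.
- split; first by move=> x [].
    by split; [apply/quadrantE|]; rewrite !mxE; lra.
  move=> x y [Qx Lx] y0 yx; split => //.
  by have [] := (le_coordE y x).1 yx; lra.
- split; last exact: segment_separates.
  split; last exact: segment_image.
  + exact: derivable_line.
  + move=> t _; rewrite derive1_line; apply/eqP => /rowP/(_ 0).
    by rewrite !mxE /= => /eqP; rewrite oner_eq0.
  + by move=> s t _ _; rewrite !cE => /rowP/(_ 0); rewrite !mxE.
- by case=> _; rewrite !mxE; lra.
- rewrite segment_image; apply: continuous_compact (@segment_compact R 0 1).
  by apply: continuous_subspaceT => t; exact: continuous_line.
- move=> t t01; exists n; first exact: segment_outward_normal.
  by move=> i; rewrite mxE; case: ifP.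
Qed.

End Segment.

(** * Two optimal functions *)

Section OptimalFunctions.
Variable R : realType.
Implicit Types (x y : 'rV[R]_2) (i : 'I_2) (k e : R).

Definition capped_plus k x : R :=
  Num.min (2 * x 0 0 + x 0 1) 2 + k * x 0 1.

(** The slopes of the linear forms 2 x1 + x2 and k x2. *)
Let w i : R := if i == 0 then 2 else 1.
Let v k i : R := if i == 0 then 0 else k.

Let w_gt0 i : 0 < w i. Proof. by rewrite /w; case: ifP. Qed.

Lemma capped_plus_shift k x i e :
  capped_plus k (x + e *: unit_vec R i) =
  Num.min (2 * x 0 0 + x 0 1 + e * w i) 2 + k * x 0 1 + e * v k i.
Proof.
rewrite /capped_plus /w /v !mxE.
by elim/ord2_ind: i; rewrite /= ?mulr1 ?mulr0 ?addr0 -?addrA;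
  congr (Num.min _ _ + _); ring.
Qed.

(** Concavity of min (., m), in the form that gives both submodularity and
    diminishing returns of the capped function: the pair c, d is less spread out
    than a, b. *)
Lemma min_concave (a b c d m : R) : a <= c -> a <= d -> a + b = c + d ->
  Num.min a m + Num.min b m <= Num.min c m + Num.min d m.
Proof. by move=> ac ad ab; rewrite /Num.min; do ![case: ltP => ?]; lra. Qed.

Lemma capped_plus_el k : 0 <= k -> entropy_like (capped_plus k).
Proof.
move=> k0; split.
- move=> x y _ _; rewrite /capped_plus !mxE.
  set s := 2 * x 0 0 + x 0 1; set t := 2 * y 0 0 + y 0 1.
  set a := 2 * Num.min _ _ + _; set b := 2 * Num.max _ _ + _.
  have : Num.min a 2 + Num.min b 2 <= Num.min s 2 + Num.min t 2.
    by apply: min_concave; rewrite /a /b /s /t;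
      case: (lerP (x 0 0)) => ?; case: (lerP (x 0 1)) => ?; lra.
  by case: (lerP (x 0 1)) => ?; lra.
- by rewrite /capped_plus !mxE !mulr0 !addr0 min_l.
- move=> x y Qx /le_coordE[xy0 xy1].
  rewrite /capped_plus lerD ?ler_wpM2l// le_min !ge_min lexx orbT andbT.
  by rewrite lerD ?ler_wpM2l.
- move=> x i l e _ l0 e0 /=.
  rewrite -[x + _ + _]addrA -scalerDl !capped_plus_shift /capped_plus.
  set s := 2 * x 0 0 + x 0 1.
  have lw : 0 <= l * w i by rewrite mulr_ge0// ltW.
  have ew : 0 <= e * w i by rewrite mulr_ge0// ltW.
  have := @min_concave s (s + (l + e) * w i) (s + e * w i) (s + l * w i) 2.
  by move=> /(_ ltac:(lra) ltac:(lra) ltac:(lra)); lra.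
Qed.

Lemma capped_plus_right_inside k x i : 2 * x 0 0 + x 0 1 < 2 ->
  right_partial (capped_plus k) i x = (w i + v k i)%:E.
Proof.
move=> x2; apply: lim_near_cst => //; near=> e.
have e0 : 0 < e by near: e; exact: nbhs_right_gt.
have e1 : e < (2 - (2 * x 0 0 + x 0 1)) / w i.
  by near: e; apply: nbhs_right_lt; rewrite divr_gt0// subr_gt0.
move: e1; rewrite ltr_pdivlMr// => e1.
congr EFin; rewrite capped_plus_shift /capped_plus !min_l; try lra.
by field; rewrite lt0r_neq0.
Unshelve. all: by end_near. Qed.

Lemma capped_plus_right_on k x i : 2 * x 0 0 + x 0 1 = 2 ->
  right_partial (capped_plus k) i x = (v k i)%:E.
Proof.
move=> x2; apply: lim_near_cst => //; near=> e.
have e0 : 0 < e by near: e; exact: nbhs_right_gt.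
have ew : 0 < e * w i by rewrite mulr_gt0.
congr EFin; rewrite capped_plus_shift /capped_plus !min_r; try lra.
by field; rewrite lt0r_neq0.
Unshelve. all: by end_near. Qed.

Lemma capped_plus_left_on k x i : 2 * x 0 0 + x 0 1 = 2 ->
  left_partial (capped_plus k) i x = (w i + v k i)%:E.
Proof.
move=> x2; apply: lim_near_cst => //; near=> e.
have e0 : 0 < e by near: e; exact: nbhs_right_gt.
have ew : 0 < e * w i by rewrite mulr_gt0.
congr EFin; rewrite -scaleNr capped_plus_shift /capped_plus !min_l; try lra.
by field; rewrite lt0r_neq0.
Unshelve. all: by end_near. Qed.

Lemma capped_plus_feasible k : feasible (@segment R) (capped_plus k).
Proof.
move=> p [_ p2] _ i.
rewrite capped_plus_left_on// capped_plus_right_on// -EFinB lee_fin addrK.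
by rewrite /w; case: ifP => _; lra.
Qed.

(** The slopes at the origin are 2 and 1 + k, so every k <= 1 is free. *)
Lemma capped_plus_cost k : k <= 1 -> cost (capped_plus k) = 2%:E.
Proof.
move=> k1; have inside : 2 * (0 : 'rV[R]_2) 0 0 + (0 : 'rV[R]_2) 0 1 < 2.
  by rewrite !mxE; lra.
rewrite /cost !capped_plus_right_inside//.
by rewrite /w /v /= addr0 max_l// lee_fin; lra.
Qed.

Lemma OPT_segment : OPT (@segment R) = 2%:E.
Proof.
apply/eqP; rewrite eq_le; apply/andP; split.
  apply: ereal_inf_lbound; exists (capped_plus 0); last first.
    by apply: capped_plus_cost.
  by split; [exact: capped_plus_el|exact: capped_plus_feasible].
apply: le_ereal_inf_tmp => _ [f [f_el f_feas] <-].
by rewrite /cost le_max segment_cost_ge.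
Qed.

End OptimalFunctions.

Theorem mainTheorem4 (R : realType) :
  exists S : set 'rV[R]_2,
    s_surface S /\ (OPT S < +oo)%E /\
    exists f g : 'rV[R]_2 -> R,
      (entropy_like f /\ feasible S f) /\
      (entropy_like g /\ feasible S g) /\
      (exists x : 'rV[R]_2, quadrant x /\ f x <> g x) /\
      cost f = OPT S /\ cost g = OPT S.
Proof.
exists (@segment R); split; first exact: segment_s_surface.
rewrite OPT_segment; split; first exact: ltry.
exists (capped_plus 0), (capped_plus 1).
split; first by split; [exact: capped_plus_el|exact: capped_plus_feasible].
split; first by split; [exact: capped_plus_el|exact: capped_plus_feasible].
split; last by split; exact: capped_plus_cost.
exists (vec2 0 1); split; first exact: quadrant_vec2.
by rewrite /capped_plus !mxE /=; lra.
Qed.
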